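(* Let $G$ be a finite soluble group. Then $\alpha(G)\leqslant \lambda(G)$. Moreover, if the derived subgroup $G'$ of $G$ is nilpotent, then $\alpha(G)\leqslant \delta(G)$.
   Context: For a finite group $G$, $\mathrm{Frat}(G)$ denotes the Frattini subgroup. The intersection number $\alpha(G)$ is the minimal number of maximal subgroups of $G$ whose intersection equals $\mathrm{Frat}(G)$. $\lambda(G)$ is the chief length of $G$ (number of factors in a chief series). A chief factor $H/K$ of $G$ is Frattini if $H/K\leqslant \mathrm{Frat}(G/K)$; $\delta(G)$ is the number of non-Frattini chief factors in a chief series of $G$ (independent of the chosen series). *)

(* Defs.v *)
From mathcomp Require Import all_boot all_fingroup all_solvable.
Set Implicit Arguments. Unset Strict Implicit. Unset Printing Implicit Defensive.
Local Open Scope group_scope.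

(* A family X of subgroups of G "realizes" the Frattini subgroup if every
   member of X is a maximal subgroup of G and their intersection (taken inside G,
   so that the empty family intersects to G) equals 'Phi(G). *)
Definition frat_family (gT : finGroupType) (G : {group gT}) (X : {set {group gT}}) :=
  [forall M in X, maximal M G] && (G :&: \bigcap_(M in X) (M : {set gT}) == 'Phi(G)).

(* alpha(G): the minimal number of maximal subgroups of G whose intersection is
   'Phi(G).  (The default value of the min is never reached: the set of all
   maximal subgroups is a frat_family.) *)
Definition alpha (gT : finGroupType) (G : {group gT}) : nat :=
  \big[minn/#|{set {group gT}}|]_(X : {set {group gT}} | frat_family G X) #|X|.

(* Chief series of G: 1 = G_0 < G_1 < ... < G_n = G encoded by s = [:: G_1; ...; G_n],
   each G_{i-1} a maximal G-normal proper subgroup of G_i, G_i normal in G. *)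
Definition chief_series (gT : finGroupType) (G : {group gT}) (s : seq {group gT}) :=
  (G.-chief).-series 1%G s && (last 1%G s == G).

Definition frattini_factor (gT : finGroupType) (G K H : {group gT}) : bool :=
  (H / K) \subset 'Phi(G / K).

Definition delta_of (gT : finGroupType) (G : {group gT}) (s : seq {group gT}) : nat :=
  count (fun KH : {group gT} * {group gT} => ~~ frattini_factor G KH.1 KH.2)
        (zip (1%G :: s) s).

(* Main.v *)
(* Bound by lambda(G): one may assume 'Phi(G) = 1.  Let N be a minimal normal
   subgroup, complemented by a maximal subgroup M, and P / N = 'Phi(G / N).
   Induction on G / N brings the intersection down to P at the cost of
   lambda(G / P) maximal subgroups.  As P :&: M is nilpotent and acts faithfully
   and coprimely on N, climbing along chief factors U < V of G below P, some
   conjugate of M avoids the abelian group left in V once U has been avoided: so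
   one conjugate of M per chief factor of G inside P is enough.

   Bound by delta(G), G' nilpotent: F = G' 'Phi(G) is abelian modulo 'Phi(G), so
   as many maximal subgroups as there are chief factors in F / 'Phi(G) bring the
   intersection down to D with D :&: F = 'Phi(G).  Then D / 'Phi(G) is abelian
   and embeds in A = G / F; its Omega_1 is destroyed prime by prime, and the
   number of primes is at most that of |Omega_1(A)| = |A : Mho^1(A)|, hence of
   |A : 'Phi(A)|, which counts the non-Frattini chief factors above F. *)

Require Import Defs.
From mathcomp Require Import all_boot all_fingroup all_solvable.
Set Implicit Arguments.
Unset Strict Implicit.
Unset Printing Implicit Defensive.
Local Open Scope group_scope.

(** * Chief series *)

Section ChiefPaths.

Variables (gT : finGroupType) (G : {group gT}).
Implicit Types (A B H K L M N : {group gT}) (s : seq {group gT}).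

Lemma chief_factorP {K N} :
  reflect [/\ K <| G, K \proper N, N <| G
            & forall H, H <| G -> K \subset H -> H \proper N -> H = K]
          (chief_factor G K N).
Proof.
apply: (iffP andP) => [[/maxgroupP[/andP[pKN nKG] maxK] nN] | [nK pKN nN maxK]].
  split=> // [|H nH sKH pHN].
    by rewrite /normal nKG (subset_trans (proper_sub pKN) (normal_sub nN)).
  by apply/group_inj/maxK=> //; rewrite pHN normal_norm.
split=> //; apply/maxgroupP; split=> [|H /andP[pHN nHG] sKH].
  by rewrite pKN normal_norm.
rewrite (maxK H) // /normal nHG andbT.
exact: subset_trans (proper_sub pHN) (normal_sub nN).
Qed.

Lemma chief_factor_exists K N : K <| G -> N <| G -> K \proper N ->
  {A : {group gT} | chief_factor G K A & A \subset N}.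
Proof.
move=> nK nN pKN.
have [|A /mingroupP[/andP[pKA nAG] minA] sAN] :=
  @mingroup_exists _ [pred H : {group gT} | (K \proper H) && (H <| G)] N.
  by rewrite /= pKN.
exists A => //; apply/chief_factorP; split=> // H nH sKH pHA.
apply/eqP; apply/idPn => neHK.
have pKH : K \proper H by rewrite properEneq sKH andbT eq_sym.
have eHA : H :=: A by apply: minA (proper_sub pHA); apply/andP.
by rewrite eHA properxx in pHA.
Qed.

Lemma chief_path_exists K N : K <| G -> N <| G -> K \subset N ->
  exists2 s, (G.-chief).-series K s & last K s = N.
Proof.
move=> nK nN sKN; have [m] := ubnP (#|N| - #|K|).
elim: m K nK sKN => // m IHm K nK sKN lem.
have [-> | neKN] := eqVneq K N; first by exists [::].
have [|A chA sAN] := chief_factor_exists nK nN.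
  by rewrite properEneq neKN.
have [_ pKA nA _] := chief_factorP chA.
have [|s chs ls] := IHm A nA sAN.
  apply: leq_trans (lem : _ <= m); rewrite ltn_sub2l ?proper_card //.
  exact: proper_sub_trans pKA sAN.
by exists (A :: s); rewrite //= chA.
Qed.

(** [N :&: N'] is normal in [G] and lies between [K] and [N'], so it is [K] unless [N'] is inside
    [N], which would force [N = N']. In the second part [H :&: N' = K] likewise, and Dedekind's law
    gives [H = N]. *)
Lemma chief_diamond K N N' :
  chief_factor G K N -> chief_factor G K N' -> N <> N' ->
  N :&: N' = K /\ chief_factor G N (N <*> N').
Proof.
move=> /chief_factorP[nK pKN nN maxN] /chief_factorP[_ pKN' nN' maxN'] neNN'.
have defK (X : {group gT}) :
    X <| G -> X \subset N' -> K \subset X -> ~~ (N' \subset X) -> X = K.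
  by move=> nX sXN' sKX nsN'X; apply: maxN' => //; rewrite properE sXN'.
have nsN'N : ~~ (N' \subset N).
  apply/negP=> sN'N; case: (eqVproper sN'N) => [e|pN'N].
    by apply: neNN'; apply: group_inj.
  have e := maxN _ nN' (proper_sub pKN') pN'N.
  by rewrite e properxx in pKN'.
split.
  rewrite -(defK (N :&: N')%G) ?normalI ?subsetIr //.
    by rewrite subsetI !proper_sub.
  by rewrite subsetI negb_and nsN'N.
apply/chief_factorP; split=> //.
- by rewrite properE joing_subl join_subG subxx nsN'N.
- by rewrite /= normalY.
move=> H nH sNH pHNN'.
have eK : (H :&: N')%G = K.
  apply: defK; rewrite ?normalI ?subsetIr //.
    rewrite subsetI (subset_trans (proper_sub pKN)) //.
    exact: proper_sub.
  apply: contraTN pHNN' => /subsetIP[sN'H _].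
  by rewrite properE negb_and negbK join_subG sNH sN'H orbT.
apply/eqP; rewrite -val_eqE eq_sym eqEsubset sNH /=.
have: H \subset (N * N') :&: H.
  rewrite subsetI subxx andbT -norm_joinEr; first exact: proper_sub.
  exact: subset_trans (normal_sub nN') (normal_norm nN).
rewrite -group_modl // setIC; have /(congr1 val) /= -> := eK.
by rewrite mulGSid ?(proper_sub pKN).
Qed.

(** The explicit start [K] allows concatenation. Constant weight 1 gives the length, and
    [nonfrattini] gives [delta_of]. *)
Definition chief_weight (w : {group gT} -> {group gT} -> nat) K s : nat :=
  \sum_(p <- zip (K :: s) s) w p.1 p.2.

Lemma chief_weight_cons w K N s :
  chief_weight w K (N :: s) = (w K N + chief_weight w N s)%N.
Proof. by rewrite /chief_weight /= big_cons. Qed.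

Lemma chief_weight_nil w K : chief_weight w K [::] = 0%N.
Proof. by rewrite /chief_weight big_nil. Qed.

Lemma chief_weight_cat w K s1 s2 :
  chief_weight w K (s1 ++ s2) =
  (chief_weight w K s1 + chief_weight w (last K s1) s2)%N.
Proof.
elim: s1 K => [|N s1 IHs] K /=; first by rewrite chief_weight_nil.
by rewrite !chief_weight_cons IHs addnA.
Qed.

(* Jordan-Hoelder: it is enough that the weight be preserved by the elementary
   exchange replacing K < N < NN' by K < N' < NN'. *)
Lemma chief_weight_unique w :
  (forall K N N', chief_factor G K N -> chief_factor G K N' -> N <> N' ->
     w K N + w N (N <*> N')%G = w K N' + w N' (N <*> N')%G)%N ->
  forall K s s', K <| G ->
    (G.-chief).-series K s -> (G.-chief).-series K s' ->
    last K s = G -> last K s' = G ->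
  chief_weight w K s = chief_weight w K s'.
Proof.
move=> exch K; have [m] := ubnP (#|G| - #|K|).
elim: m K => // m IHm K lem s s' nK.
have noG s1 : (G.-chief).-series G s1 -> s1 = [::].
  case: s1 => //= N s1 /andP[/chief_factorP[_ pGN /normal_sub sNG _] _].
  by rewrite properE sNG andbF in pGN.
case: s => [|N s] /=; first by move=> _ + eK; rewrite eK => /noG->.
case: s' => [|N' s'] /=.
  by move=> + _ _ eK; rewrite eK => /(noG (_ :: _)).
case/andP=> chN chs /andP[chN' chs'] ls ls'; rewrite !chief_weight_cons.
have lt (X : {group gT}) : chief_factor G K X -> X <| G /\ #|G| - #|X| < m.
  move/chief_factorP=> [_ pKX nX _]; split=> //.
  apply: leq_trans (lem : _ <= m).
  rewrite ltn_sub2l ?proper_card //.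
  exact: proper_sub_trans pKX (normal_sub nX).
have [[nN ltN] [nN' ltN']] := (lt _ chN, lt _ chN').
case: (eqVneq N N') chs' ls' => [<- | /eqP neNN'] chs' ls'.
  by congr (_ + _)%N; apply: IHm.
have nNN' : (N <*> N')%G <| G by rewrite /= normalY.
(* By induction both tails may be replaced by series through [N <*> N'] that share the tail [u];
   only the exchange remains. *)
have [u chu lu] := chief_path_exists nNN' (normal_refl G) (normal_sub nNN').
have chNN' := (chief_diamond chN chN' neNN').2.
have chN'N : chief_factor G N' (N <*> N')%G.
  have := (chief_diamond chN' chN (nesym neNN')).2.
  by congr (is_true (chief_factor _ _ _)); rewrite joingC.
rewrite (IHm N ltN s ((N <*> N')%G :: u)) //= ?chNN' //.
rewrite (IHm N' ltN' s' ((N <*> N')%G :: u)) //= ?chN'N //.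
by rewrite !chief_weight_cons !addnA exch.
Qed.

End ChiefPaths.
Arguments chief_factorP {gT G K N}.

(** * Maximal subgroups and Frattini factors *)

Section Maximal.

Variables (gT : finGroupType) (G : {group gT}).
Implicit Types (A B H K M N X : {group gT}).

Lemma mul_maximal A M :
  maximal M G -> A <| G -> ~~ (A \subset M) -> A * M = G.
Proof.
move=> /maxgroupP[/andP[sMG _] maxM] /andP[sAG nAG] nsAM.
rewrite -norm_joinEr; last exact: subset_trans sMG nAG.
apply/eqP; rewrite eqEproper join_subG sAG sMG.
by apply: contra nsAM => /maxM <-; rewrite ?joing_subl ?joing_subr.
Qed.

(** [A :&: M] is normalised by [M], and also by [A] because it contains the derived subgroup of [A];
    these two generate [G]. *)
Lemma normal_cap_maximal A M :
    maximal M G -> A <| G -> [~: A, A] \subset M -> ~~ (A \subset M) ->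
  A :&: M <| G.
Proof.
move=> maxM nA sA'M nsAM; have defG := mul_maximal maxM nA nsAM.
have [sAG nAG] := andP nA; have sMG := proper_sub (maxgroupp maxM).
rewrite /normal subIset ?sAG // -{1}defG mul_subG //.
  by rewrite sub_der1_norm ?subsetIl // subsetI der_sub.
by rewrite normsI ?normG // (subset_trans sMG).
Qed.

Lemma subset_maximal M H : maximal M G -> maximal H G -> M \subset H -> M :=: H.
Proof. by move=> /maxgroupP[_ maxM] /maxgroupp pH sMH; rewrite (maxM H). Qed.

Lemma sub_PhiP {H} : H \subset G ->
  reflect (forall M, maximal M G -> H \subset M) (H \subset 'Phi(G)).
Proof.
move=> sHG; apply: (iffP bigcapsP) => sH M => [maxM | /predU1P[-> // | /sH //]].
by rewrite sH // /maximal_eq maxM orbT.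
Qed.

End Maximal.
Arguments sub_PhiP {gT G H}.

Section FrattiniFactor.

Variables (gT : finGroupType) (G : {group gT}).
Implicit Types (K M N : {group gT}).

(** Maximal subgroups of [G / K] correspond to those of [G] above [K], which removes the quotient
    from the definition. *)
Lemma frattini_factorE K N : K <| G -> N \subset G ->
  frattini_factor G K N =
  [forall M : {group gT}, maximal M G && (K \subset M) ==> (N \subset M)].
Proof.
move=> nK sNG; have nKN := subset_trans sNG (normal_norm nK).
apply/(sub_PhiP (quotientS K sNG))/'forall_implyP => sN M.
  case/andP=> maxM sKM; have sMG := proper_sub (maxgroupp maxM).
  have nKM := normalS sKM sMG nK.
  by rewrite -(quotientSGK nKN) // sN // quotient_maximal.
move=> maxM; rewrite sub_quotient_pre // sN //.
by rewrite -(quotientGK nK) cosetpre_maximal maxM sub_cosetpre.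
Qed.

Lemma frattini_factorP {K N} : K <| G -> N \subset G ->
  reflect (forall M, maximal M G -> K \subset M -> N \subset M)
          (frattini_factor G K N).
Proof.
move=> nK sNG; rewrite frattini_factorE //.
apply: (iffP 'forall_implyP) => [sN M maxM sKM | sN M /andP[]]; last exact: sN.
by rewrite sN // maxM.
Qed.

Lemma frattini_factorPn {K N} : K <| G -> N \subset G ->
  reflect (exists M, [/\ maximal M G, K \subset M & ~~ (N \subset M)])
          (~~ frattini_factor G K N).
Proof.
move=> nK sNG; rewrite frattini_factorE // negb_forall.
apply: (iffP existsP) => -[M]; first rewrite negb_imply => /andP[/andP[]].
  by exists M.
by case=> maxM sKM nsNM; exists M; rewrite maxM sKM.
Qed.

End FrattiniFactor.
Arguments frattini_factorP {gT G K N}.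
Arguments frattini_factorPn {gT G K N}.

(** * Non-Frattini chief factors *)

Section FrattiniWeight.

Variables (gT : finGroupType) (G : {group gT}).
Hypothesis solG : solvable G.
Implicit Types (K M N : {group gT}).

Lemma chief_factor_der1 K N : chief_factor G K N -> [~: N, N] \subset K.
Proof.
move=> chN; have [nK /proper_sub sKN /andP[sNG _] _] := chief_factorP chN.
have nKN := subset_trans sNG (normal_norm nK).
have [_ _ /is_abelemP[p _ /abelem_abelian abN]] :=
  minnormal_solvable (chief_factor_minnormal chN)
  (quotientS K sNG) (quotient_sol K solG).
by rewrite -quotient_cents2 //.
Qed.

Lemma cap_chief_factor_maximal K N M : chief_factor G K N -> maximal M G ->
  K \subset M -> ~~ (N \subset M) -> N :&: M = K.
Proof.
move=> chN maxM sKM nsNM; have [nK pKN nN minN] := chief_factorP chN.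
have nNM := normal_cap_maximal maxM nN
  (subset_trans (chief_factor_der1 chN) sKM) nsNM.
rewrite -(minN (N :&: M)%G nNM) //.
  by rewrite subsetI sKM proper_sub.
by rewrite properE subsetIl subsetI subxx.
Qed.

(** Take [L] maximal above [N'] and [M :&: M']. These do not generate [G]: otherwise Dedekind's law
    and [N' :&: M = K] put [M] inside [M'], so [M = M'] contains [N]. If [N] were inside [L], so
    would be [M' = N (M :&: M')], and [L = M'] would contain [N']. *)
Lemma supplement_exchange K N N' M M' :
    chief_factor G K N -> chief_factor G K N' ->
    maximal M G -> K \subset M -> ~~ (N \subset M) -> ~~ (N' \subset M) ->
    maximal M' G -> N \subset M' -> ~~ (N' \subset M') ->
  exists2 L : {group gT}, maximal L G & N' \subset L /\ ~~ (N \subset L).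
Proof.
move=> chN chN' maxM sKM nsNM nsN'M maxM' sNM' nsN'M'.
have [_ pKN nN _] := chief_factorP chN; have [_ _ nN' _] := chief_factorP chN'.
have sMG := proper_sub (maxgroupp maxM).
have nN'I : M :&: M' \subset 'N(N') :=
  subset_trans (subset_trans (subsetIl _ _) sMG) (normal_norm nN').
have [|defG|[L maxL]] := @maximal_exists _ (N' <*> (M :&: M')) G.
- by rewrite join_subG (normal_sub nN') subIset ?sMG.
- have eG : N' <*> (M :&: M') = G := defG.
  case/negP: nsNM; rewrite (subset_maximal maxM maxM') //.
  have: M \subset N' * (M :&: M') :&: M.
    by rewrite subsetI subxx andbT -norm_joinEr // eG.
  rewrite -(normC nN'I).
  rewrite -group_modl ?subsetIl // => sMM.
  apply: subset_trans sMM _; rewrite mul_subG ?subsetIr //.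
  by rewrite (cap_chief_factor_maximal chN') // (subset_trans (proper_sub pKN)).
rewrite join_subG => /andP[sN'L sIL]; exists L => //; split=> //.
apply: contra nsN'M' => sNL; rewrite (subset_maximal maxM' maxL) //.
have: M' \subset N * M :&: M'.
  rewrite (mul_maximal maxM) // subsetI subxx andbT.
  by rewrite proper_sub ?(maxgroupp maxM').
by rewrite -group_modl // => /subset_trans; apply; rewrite mul_subG.
Qed.

Definition nonfrattini K N : nat := ~~ frattini_factor G K N.

(** If a lower factor is Frattini, the exchange just swaps the two weights ([frat1]). If neither is,
    the upper factors have equal weight by [supplement_exchange] ([frat2]). *)
Lemma nonfrattini_exchange K N N' :
    chief_factor G K N -> chief_factor G K N' -> N <> N' ->
  (nonfrattini K N + nonfrattini N (N <*> N')%G =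
   nonfrattini K N' + nonfrattini N' (N <*> N')%G)%N.
Proof.
move=> chN chN' neNN'.
have [nK /proper_sub sKN nN _] := chief_factorP chN.
have [_ /proper_sub sKN' nN' _] := chief_factorP chN'.
have sNG := normal_sub nN; have sN'G := normal_sub nN'.
have sJG : N <*> N' \subset G by rewrite join_subG sNG.
have frat1 (A B : {group gT}) : chief_factor G K A -> chief_factor G K B ->
    frattini_factor G K A ->
  frattini_factor G B (A <*> B) /\
  frattini_factor G K B = frattini_factor G A (A <*> B).
  move=> chA chB; have [_ /proper_sub sKA nA _] := chief_factorP chA.
  have [_ /proper_sub sKB nB _] := chief_factorP chB.
  have sAG := normal_sub nA; have sBG := normal_sub nB.
  have sAB : A <*> B \subset G by rewrite join_subG sAG.
  move=> /(frattini_factorP nK sAG) fA; split.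
    apply/(frattini_factorP nB sAB) => M maxM sBM.
    by rewrite join_subG sBM fA // (subset_trans sKB).
  apply/(frattini_factorP nK sBG)/(frattini_factorP nA sAB) => fB M maxM.
    by move=> sAM; rewrite join_subG sAM fB // (subset_trans sKA).
  by move/(fA M maxM)/(fB M maxM); rewrite join_subG => /andP[].
have frat2 (A B : {group gT}) : chief_factor G K A -> chief_factor G K B ->
    ~~ frattini_factor G K A ->
  ~~ frattini_factor G A (A <*> B) -> ~~ frattini_factor G B (A <*> B).
  move=> chA chB; have [_ /proper_sub sKA nA _] := chief_factorP chA.
  have [_ /proper_sub sKB nB _] := chief_factorP chB.
  have sAG := normal_sub nA; have sBG := normal_sub nB.
  have sAB : A <*> B \subset G by rewrite join_subG sAG.
  case/(frattini_factorPn nK sAG)=> M [maxM sKM nsAM].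
  case/(frattini_factorPn nA sAB)=> M' [maxM' sAM'].
  rewrite join_subG sAM' /= => nsBM'.
  apply/(frattini_factorPn nB sAB); have [sBM | nsBM] := boolP (B \subset M).
    by exists M; rewrite join_subG negb_and nsAM.
  have [L maxL [sBL nsAL]] :=
    supplement_exchange chA chB maxM sKM nsAM nsBM maxM' sAM' nsBM'.
  by exists L; rewrite join_subG negb_and nsAL.
have eJ : (N' <*> N)%G = (N <*> N')%G by apply: group_inj; rewrite /= joingC.
rewrite /nonfrattini.
have [fN | nfN] := boolP (frattini_factor G K N).
  have [-> ->] := frat1 _ _ chN chN' fN; exact: addnC.
have [fN' | nfN'] := boolP (frattini_factor G K N').
  have [] := frat1 _ _ chN' chN fN'; rewrite eJ => -> <-.
  by rewrite (negbTE nfN).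
congr (_ + _)%N; congr (nat_of_bool _); apply/idP/idP; first exact: frat2.
by rewrite -eJ; apply: frat2.
Qed.

Lemma delta_ofE s : delta_of G s = chief_weight nonfrattini 1%G s.
Proof.
rewrite /delta_of /chief_weight -sum1_count big_mkcond /=.
by apply: eq_bigr => p _; rewrite /nonfrattini; case: frattini_factor.
Qed.

(** The first factor whose top is not inside [M] still has its bottom inside [M], so it is not
    Frattini. *)
Lemma nonfrattini_separated (A B M : {group gT}) s : A <| G ->
    maximal M G -> A \subset M -> ~~ (B \subset M) ->
    (G.-chief).-series A s -> last A s = B ->
  0 < chief_weight nonfrattini A s.
Proof.
move=> nA maxM sAM nsBM; elim: s A nA sAM => [|N s IHs] A nA sAM /=.
  by move=> _ eAB; rewrite -eAB sAM in nsBM.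
case/andP=> chN chs ls; have [_ _ nN _] := chief_factorP chN.
rewrite chief_weight_cons; have [sNM | nsNM] := boolP (N \subset M).
  by rewrite addn_gt0 IHs ?orbT.
rewrite addn_gt0 lt0b; apply/orP; left.
by apply/(frattini_factorPn nA (normal_sub nN)); exists M.
Qed.

End FrattiniWeight.

(** * Number of prime factors *)

Section PrimeLength.

(** This is Omega(n): prime factors are counted with multiplicity. *)
Definition prime_length n := \sum_(p < n.+1) logn p n.

Lemma prime_length_widen m n :
  0 < n <= m -> prime_length n = \sum_(p < m.+1) logn p n.
Proof.
case/andP=> n_gt0 le_nm; rewrite /prime_length.
rewrite (big_ord_widen m.+1 (logn^~ n)) ?ltnS //.
rewrite big_mkcond; apply: eq_bigr => p _; case: ltnP => // ltnp.
rewrite lognE; case: and3P => // -[_ _ /(dvdn_leq n_gt0)].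
by rewrite leqNgt ltnp.
Qed.

Lemma prime_lengthM m n : 0 < m -> 0 < n ->
  prime_length (m * n) = (prime_length m + prime_length n)%N.
Proof.
move=> m0 n0; rewrite [in RHS](@prime_length_widen (m * n)%N) ?m0 ?leq_pmulr //.
rewrite (@prime_length_widen (m * n)%N n) ?n0 ?leq_pmull // -big_split /=.
by apply: eq_bigr => p _; rewrite lognM.
Qed.

Lemma prime_length_gt0 n : 1 < n -> 0 < prime_length n.
Proof.
move=> n1; have n0 := ltnW n1.
have ltp : pdiv n < n.+1 by rewrite ltnS dvdn_leq ?pdiv_dvd.
rewrite /prime_length (bigD1 (Ordinal ltp)) //= addn_gt0.
by rewrite logn_gt0 mem_primes pdiv_prime ?n0 ?pdiv_dvd.
Qed.

Lemma prime_length1 : prime_length 1 = 0%N.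
Proof. by rewrite /prime_length big1 // => p _; rewrite logn1. Qed.

Lemma prime_length_prime p : prime p -> prime_length p = 1%N.
Proof.
move=> p_pr; rewrite /prime_length (bigD1 ord_max) //= logn_prime // eqxx.
rewrite big1 ?addn0 // => i /negbTE neip; rewrite logn_prime //.
by rewrite -val_eqE /= eq_sym in neip; rewrite eq_sym in neip; rewrite neip.
Qed.

Lemma dvdn_prime_length m n : 0 < n -> m %| n ->
  prime_length m <= prime_length n.
Proof.
move=> n0 /dvdnP[k def_n]; rewrite def_n muln_gt0 in n0 *.
by case/andP: n0 => k0 m0; rewrite prime_lengthM // leq_addl.
Qed.

End PrimeLength.

(** * Intersections of maximal subgroups *)

Section Families.

Variables (gT : finGroupType) (G : {group gT}).
Implicit Types (A B D F M N T : {group gT}) (X : {set {group gT}}).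

(** The default value is not neutral for [minn] on [nat], so the bound is read off the fold by
    induction. *)
Lemma alpha_le X : frat_family G X -> alpha G <= #|X|.
Proof.
rewrite /alpha => fX; have := mem_index_enum X.
elim: (index_enum _) => // Y r IHr; rewrite inE big_cons.
case/predU1P=> [<- | /IHr le]; first by rewrite fX geq_minl.
by case: ifP => // _; rewrite geq_min le orbT.
Qed.

Lemma frat_familyE X : {in X, forall M : {group gT}, maximal M G} ->
  G :&: \bigcap_(M in X) M \subset 'Phi(G) -> frat_family G X.
Proof.
move=> maxX sXP; apply/andP; split; first by apply/forall_inP.
rewrite eqEsubset sXP subsetI Phi_sub; apply/bigcapsP => M /maxX.
exact: Phi_sub_max.
Qed.

Lemma exists_maximal_not_sub A :
    A \subset G -> ~~ (A \subset 'Phi(G)) ->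
  exists2 M : {group gT}, maximal M G & ~~ (A \subset M).
Proof.
move=> sAG nsAP; apply/exists_inP; apply: contraR nsAP.
rewrite negb_exists_in => /forall_inP sA; apply/(sub_PhiP sAG) => M /sA.
by rewrite negbK.
Qed.

Lemma bigcap_setU1 M X : \bigcap_(H in M |: X) H = M :&: \bigcap_(H in X) H.
Proof.
have [MX | nMX] := boolP (M \in X); last exact: big_setU1.
by rewrite setUC (setUidPl _) ?sub1set // (big_setD1 M MX) /= setIA setIid.
Qed.

Lemma maximal_setU1 M X :
    maximal M G -> {in X, forall H : {group gT}, maximal H G} ->
  {in M |: X, forall H : {group gT}, maximal H G}.
Proof. by move=> maxM maxX H /setU1P[-> | /maxX]. Qed.

Lemma leq_card_setU1 M X n : #|X| <= n -> #|M |: X| <= n.+1.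
Proof. by rewrite cardsU1 => leX; case: (M \notin X) => //=; apply: leqW. Qed.

(* Each maximal subgroup used cuts the section above 'Phi(G) by at least one
   prime. *)
Lemma cut_subgroup T : 'Phi(G) \subset T -> T \subset G ->
  exists X, [/\ {in X, forall M : {group gT}, maximal M G},
                T :&: \bigcap_(M in X) M = 'Phi(G)
              & #|X| <= prime_length #|T : 'Phi(G)|].
Proof.
have [m] := ubnP #|T|; elim: m T => // m IHm T ltTm sPT sTG.
have [sTP | nsTP] := boolP (T \subset 'Phi(G)).
  exists set0; rewrite cards0 big_set0 setIT; split=> // [M|].
    by rewrite inE.
  by apply/eqP; rewrite eqEsubset sTP.
have [M maxM nsTM] := exists_maximal_not_sub sTG nsTP.
have pTM : T :&: M \proper T by rewrite properE subsetIl subsetI subxx.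
have sPTM : 'Phi(G) \subset T :&: M by rewrite subsetI sPT Phi_sub_max.
have [|||X [maxX capX leX]] := IHm (T :&: M)%G; rewrite ?subIset ?sTG //.
  exact: leq_trans (proper_card pTM) _.
exists (M |: X); split; first exact: maximal_setU1.
  by rewrite bigcap_setU1 setIA.
rewrite -(Lagrange_index (proper_sub pTM) sPTM) prime_lengthM //.
rewrite (leq_trans (leq_card_setU1 _ leX)) // addnC -addn1 leq_add2l.
by rewrite prime_length_gt0 // indexg_gt1 proper_subn.
Qed.

(** As [B] is abelian modulo ['Phi(G)], its intersection with a maximal subgroup [M] is again normal
    in [G]. The chief series is built along the descent: between [B :&: M] and [B] it has a
    non-Frattini factor, which pays for [M]. *)
Lemma cut_abelian_section B : B <| G -> 'Phi(G) \subset B ->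
    [~: B, B] \subset 'Phi(G) ->
  exists X s, [/\ {in X, forall M : {group gT}, maximal M G},
                  B :&: \bigcap_(M in X) M = 'Phi(G),
                  (G.-chief).-series 'Phi(G)%G s, last 'Phi(G)%G s = B
                & #|X| <= chief_weight (nonfrattini G) 'Phi(G)%G s].
Proof.
have [m] := ubnP #|B|; elim: m B => // m IHm B ltBm nB sPB abB.
have nP := Phi_normal G; have sBG := normal_sub nB.
have [sBP | nsBP] := boolP (B \subset 'Phi(G)).
  have eB : B :=: 'Phi(G) by apply/eqP; rewrite eqEsubset sBP.
  exists set0, [::]; rewrite cards0 big_set0 setIT; split=> // [M|].
    by rewrite inE.
  exact/esym/group_inj.
have [M maxM nsBM] := exists_maximal_not_sub sBG nsBP.
have sPM := Phi_sub_max maxM.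
have pBM : B :&: M \proper B by rewrite properE subsetIl subsetI subxx.
have nBM : (B :&: M)%G <| G.
  by apply: normal_cap_maximal; rewrite ?(subset_trans abB).
have [||||X [s [maxX capX chs ls leX]]] := IHm (B :&: M)%G => //.
- exact: leq_trans (proper_card pBM) _.
- by rewrite subsetI sPB.
- by rewrite (subset_trans _ abB) // commgSS ?subsetIl.
have [t cht lt] := chief_path_exists nBM nB (subsetIl _ _).
exists (M |: X), (s ++ t); split; first exact: maximal_setU1.
- by rewrite bigcap_setU1 setIA.
- by rewrite cat_path chs ls.
- by rewrite last_cat ls.
rewrite chief_weight_cat ls (leq_trans (leq_card_setU1 _ leX)) //.
rewrite -addn1 leq_add2l.
exact: (nonfrattini_separated nBM maxM (subsetIr _ _) nsBM).
Qed.

Lemma prime_index_maximal M : solvable G -> M <| G -> maximal M G ->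
  prime #|G : M|.
Proof.
move=> solG nM maxM; rewrite -card_quotient ?normal_norm //.
apply: simple_sol_prime; first exact: quotient_sol.
rewrite quotient_simple //; apply/maxgroupP; have [pM maxM'] := maxgroupP maxM.
by split=> [|H /andP[pHG _]]; [rewrite pM normal_norm | apply: maxM'].
Qed.

End Families.

(** * The Frattini subgroup of an abelian group *)

Section AbelianFrattini.

(* Projecting onto the Sylow p-quotient reduces to p-groups, where
   'Phi = 'Mho^1. *)
Lemma Phi_sub_Mho (gT : finGroupType) (A : {group gT}) :
  abelian A -> 'Phi(A) \subset 'Mho^1(A).
Proof.
move=> abA; have nMA : A \subset 'N('Mho^1(A)) by apply: gFnorm.
apply/subsetP => x Phix; have Ax := subsetP (Phi_sub A) x Phix.
apply: coset_idr; first exact: (subsetP nMA).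
apply/eqP; rewrite -order_eq1; apply/negPn/negP => o1.
set o := #[_] in o1; have o0 : 0 < o by apply: order_gt0.
have p_pr : prime (pdiv o) by rewrite pdiv_prime // ltn_neqAle eq_sym o1.
set p := pdiv o in p_pr.
have nOA : A \subset 'N('O_p^'(A)) by apply: gFnorm.
have pQ : p.-group (A / 'O_p^'(A)).
  rewrite /pgroup card_quotient //.
  have := nilpotent_pcore_Hall p^' (abelian_nil abA).
  by case/and3P=> _ _; rewrite pnatNK.
have: coset 'O_p^'(A) x \in 'Mho^1(A) / 'O_p^'(A).
  rewrite [_ / _]morphim_Mho // -(Phi_Mho pQ) ?quotient_abelian //.
  apply: (subsetP (morphimF _ _ nOA)).
  by rewrite mem_morphim // (subsetP nOA).
case/morphimP=> y Ny My /(kercoset_rcoset (subsetP nOA x Ax) Ny)[z Oz def_x].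
have Az := subsetP (pcore_sub _ _) z Oz; have Ay := subsetP (Mho_sub 1 A) y My.
(* Modulo the p'-core [x] lies in ['Mho^1], so [x] is a p'-element times an element of ['Mho^1(A)];
   yet [p] divides the order of its image. *)
have: p^'.-elt (coset 'Mho^1(A) x).
  rewrite def_x morphM ?(subsetP nMA) //= (coset_id My) mulg1.
  rewrite morph_p_elt ?(subsetP nMA) //.
  exact: mem_p_elt (pcore_pgroup _ _) Oz.
by rewrite /p_elt p'natE // -/o pdiv_dvd.
Qed.

End AbelianFrattini.

(** * Groups with nilpotent derived subgroup *)

Section NilpotentDerived.

Variables (gT : finGroupType) (G : {group gT}).
Implicit Types (A B D F K M N T : {group gT}) (X : {set {group gT}}).

Lemma abelian_quotient_path F : solvable G -> F <| G -> G^`(1) \subset F ->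
  exists s, [/\ (G.-chief).-series F s, last F s = G &
    prime_length #|'Ohm_1(G / F)| <= chief_weight (nonfrattini G) F s].
Proof.
move=> solG nF sG'F; have [sFG nFG] := andP nF.
have abGF : abelian (G / F) by apply: sub_der1_abelian.
have nF_ (H : {group gT}) : F \subset H -> H \subset G -> H <| G.
  by move=> sFH; apply: sub_der1_normal; apply: subset_trans sFH.
pose P := (coset F @*^-1 'Phi(G / F))%G.
have sFP : F \subset P by apply: sub_cosetpre.
have sPG : P \subset G by rewrite -(quotientGK nF) cosetpreSK Phi_sub.
(* Above [P], the preimage of ['Phi(G / F)], each cut by a maximal subgroup has prime index and
   crosses at least one non-Frattini factor. *)
have down B : P \subset B -> B \subset G -> exists s,
    [/\ (G.-chief).-series P s, last P s = B
      & prime_length #|B : P| <= chief_weight (nonfrattini G) P s].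
  have [m] := ubnP #|B|; elim: m B => // m IHm B ltBm sPB sBG.
  have [sBP | nsBP] := boolP (B \subset P).
    have eB : B = P by apply/group_inj/eqP; rewrite eqEsubset sBP.
    by exists [::]; rewrite eB indexgg prime_length1.
  have nB := nF_ B (subset_trans sFP sPB) sBG.
  have: ~~ frattini_factor G F B.
    apply: contra nsBP; rewrite /frattini_factor sub_quotient_pre //.
    exact: subset_trans sBG nFG.
  case/(frattini_factorPn nF sBG)=> M [maxM sFM nsBM].
  have nM := nF_ M sFM (proper_sub (maxgroupp maxM)).
  have pBM : B :&: M \proper B by rewrite properE subsetIl subsetI subxx.
  have sPM : P \subset M.
    apply: (frattini_factorP nF sPG _ M) => //.
    by rewrite /frattini_factor cosetpreK.
  have [||| s [chs ls les]] := IHm (B :&: M)%G.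
  - exact: leq_trans (proper_card pBM) _.
  - by rewrite subsetI sPB.
  - by rewrite subIset ?sBG.
  have nBM : (B :&: M)%G <| G by apply: normalI.
  have [t cht lt] := chief_path_exists nBM nB (subsetIl _ _).
  exists (s ++ t); rewrite cat_path last_cat ls chs; split=> //.
  have sPBM : P \subset B :&: M by rewrite subsetI sPB.
  rewrite -(Lagrange_index (proper_sub pBM) sPBM) prime_lengthM //.
  rewrite chief_weight_cat ls addnC leq_add //.
  have defG : M * B = G.
    rewrite normC ?(mul_maximal maxM nB) //.
    exact: subset_trans (proper_sub (maxgroupp maxM)) (normal_norm nB).
  rewrite indexgI -[#|B : M|]indexMg defG.
  rewrite prime_length_prime ?prime_index_maximal //.
  exact: (nonfrattini_separated nBM maxM (subsetIr _ _) nsBM).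
have [s [chs ls les]] := down G sPG (subxx G).
have [t cht lt] := chief_path_exists nF (nF_ P sFP sPG) sFP.
exists (t ++ s); rewrite cat_path last_cat lt cht; split=> //.
rewrite chief_weight_cat lt; apply: leq_trans (leq_addl _ _).
apply: leq_trans les; apply: dvdn_prime_length => //.
rewrite -[in #|G : P|](quotientGK nF) index_cosetpre.
(* In an abelian group the order of Omega_1 is the index of ['Mho^1], which divides the index of the
   Frattini subgroup. *)
have <- : #|G / F : 'Mho^1(G / F)| = #|'Ohm_1(G / F)|.
  by rewrite -divgS ?Mho_sub // -(mul_card_Ohm_Mho_abelian 1 abGF) mulnK.
by rewrite -(Lagrange_index (Mho_sub 1 _) (Phi_sub_Mho abGF)) dvdn_mulr.
Qed.

(** If a maximal [M] misses the derived subgroup of [N], then [N] is the product of that subgroup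
    and [N :&: M]. So [N / (N :&: M)] would be perfect, nontrivial and nilpotent. *)
Lemma der1_normal_nilpotent_sub_Phi N : N <| G -> nilpotent N ->
  N^`(1) \subset 'Phi(G).
Proof.
move=> nN nilN; have [sNG nNG] := andP nN.
have nN' : N^`(1) <| G by rewrite gFnormal_trans.
apply/(sub_PhiP (normal_sub nN')) => M maxM; apply/idPn => nsN'M.
have sMG := proper_sub (maxgroupp maxM).
have defG := mul_maximal maxM nN' nsN'M.
have defN : N^`(1) * (N :&: M) = N.
  by rewrite setIC group_modl ?der_sub // defG (setIidPr sNG).
have nsNM : ~~ (N \subset M).
  by apply: contra nsN'M; apply: subset_trans (der_sub _ _).
have pNM : N :&: M \proper N by rewrite properE subsetIl subsetI subxx.
have pnor := nilpotent_proper_norm nilN pNM.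
(* The normaliser of [N :&: M] contains [M], and by nilpotency of [N] it also contains elements of
   [N] outside [M]; hence it is [G]. *)
have nIG : N :&: M <| G.
  rewrite /normal subIset ?sNG //=.
  have nIM : M \subset 'N(N :&: M).
    by rewrite normsI ?normG // (subset_trans sMG).
  have [|eG | [L maxL sL]] := @maximal_exists _ (M <*> 'N_N(N :&: M))%G G.
  - by rewrite join_subG sMG subIset // sNG.
  - have <- : M <*> 'N_N(N :&: M) = G := eG.
    by rewrite join_subG nIM subsetIr.
  move: sL; rewrite join_subG => /andP[sML sNL].
  have eML := subset_maximal maxM maxL sML.
  case/andP: pnor => _ /negP[]; rewrite subsetI subsetIl /=.
  by apply: subset_trans sNL _; rewrite -eML.
have nIN : N \subset 'N(N :&: M) := subset_trans sNG (normal_norm nIG).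
have := quotientMidr (N :&: M)%G N^`(1); rewrite /= defN quotient_der // => eN.
have: (N / (N :&: M))^`(1) \proper N / (N :&: M).
  apply: (sol_der1_proper (nilpotent_sol (quotient_nil _ nilN))) => //.
  by rewrite -subG1 quotient_sub1 // subsetI subxx.
by rewrite -eN properxx.
Qed.

End NilpotentDerived.

Section NilpotentDerivedBound.

Variables (gT : finGroupType) (G : {group gT}).
Hypothesis solG : solvable G.

Lemma alpha_le_delta (s : seq {group gT}) :
  chief_series G s -> nilpotent G^`(1) -> alpha G <= delta_of G s.
Proof.
case/andP=> chs /eqP ls nilG'.
have nP := Phi_normal G; have [sPG nPG] := andP nP.
pose F := (G^`(1) <*> 'Phi(G))%G.
have sG'F : G^`(1) \subset F by apply: joing_subl.
have sPF : 'Phi(G) \subset F by apply: joing_subr.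
have nG' : G^`(1) <| G by apply: der_normal.
have nF : F <| G by rewrite /= normalY.
have [sFG nFG] := andP nF.
have abF : [~: F, F] \subset 'Phi(G).
  have nPG' := subset_trans (der_sub 1 G) nPG.
  rewrite -quotient_cents2 ?(subset_trans sFG) // quotientYidr //.
  by rewrite quotient_cents2 // (der1_normal_nilpotent_sub_Phi nG').
have [X1 [s1 [maxX1 capX1 chs1 ls1 leX1]]] := cut_abelian_section nF sPF abF.
have [s2 [chs2 ls2 les2]] := abelian_quotient_path solG nF sG'F.
have [s0 chs0 ls0] := chief_path_exists (normal1 G) nP (sub1G _).
(* The count is independent of the series, so one through ['Phi(G)] and [F] may be used; the
   contribution of [s0] is dropped at the end. *)
have -> : delta_of G s = chief_weight (nonfrattini G) 1%G (s0 ++ s1 ++ s2).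
  rewrite delta_ofE.
  apply: (chief_weight_unique (nonfrattini_exchange solG)); rewrite ?normal1 //.
    by rewrite !cat_path chs0 ls0 chs1 ls1.
  by rewrite !last_cat ls0 ls1.
rewrite !chief_weight_cat ls0 ls1.
pose D := (G :&: \bigcap_(M in X1) M)%G.
have sDG : D \subset G by apply: subsetIl.
have tiDF : F :&: D = 'Phi(G) by rewrite /= setIA (setIidPl sFG).
have sPD : 'Phi(G) \subset D by rewrite -tiDF subsetIr.
have nPD := subset_trans sDG nPG.
(* It suffices to cut [T] down to ['Phi(G)]: a nontrivial subgroup of [D / 'Phi(G)] meets Omega_1
   nontrivially. *)
pose T := (coset 'Phi(G) @*^-1 'Ohm_1(D / 'Phi(G)))%G.
have sPT : 'Phi(G) \subset T by apply: sub_cosetpre.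
have sTG : T \subset G.
  rewrite -(quotientGK nP) cosetpreSK.
  by rewrite (subset_trans (Ohm_sub 1 _)) ?quotientS.
have [X2 [maxX2 capX2 leX2]] := cut_subgroup sPT sTG.
have fX : frat_family G (X1 :|: X2).
  apply: frat_familyE => [M /setUP[/maxX1 | /maxX2] // |].
  pose E := (D :&: \bigcap_(M in X2) M)%G.
  have -> : G :&: \bigcap_(M in X1 :|: X2) M = E.
    by rewrite bigcap_setU /= setIA.
  have sED : E \subset D by apply: subsetIl.
  have nPE := subset_trans sED nPD.
  have sETP : E :&: T \subset 'Phi(G).
    have <- : T :&: \bigcap_(M in X2) M = 'Phi(G) := capX2.
    by rewrite subsetI subsetIr /= subIset // subsetIr.
  have tiE : E / 'Phi(G) :&: 'Ohm_1(D / 'Phi(G)) = 1.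
    apply/trivgP; rewrite /= -['Ohm_1(_)]cosetpreK -(quotientIG _ sPT).
    rewrite quotient_sub1; first exact: sETP.
    exact: subset_trans (subsetIl _ _) nPE.
  have := TI_Ohm1 tiE; rewrite (setIidPl (quotientS _ sED)) => eE.
  by rewrite -quotient_sub1 //; apply/trivgP.
apply: leq_trans (alpha_le fX) _; rewrite cardsU.
apply: leq_trans (leq_subr _ _) _; apply: leq_trans (leq_addl _ _).
apply: leq_add => //; apply: leq_trans leX2 _; apply: leq_trans les2.
apply: dvdn_prime_length => //.
have -> : #|T : 'Phi(G)| = #|'Ohm_1(D / 'Phi(G))|.
  by rewrite -[X in #|_ : X|]cosetpre1 index_cosetpre indexg1.
(* Since [F :&: D = 'Phi(G)], the quotient [D / 'Phi(G)] embeds in [G / F]. *)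
have /(isog_Ohm 1)/card_isog : D / (F :&: D) \isog D / F.
  exact: second_isog (subset_trans sDG nFG).
rewrite tiDF => ->; exact/cardSg/OhmS/quotientS.
Qed.

End NilpotentDerivedBound.

(** * Soluble groups *)

Section RegularOrbit.

Variable gT : finGroupType.
Implicit Types N T : {group gT}.

(* If n has a stabiliser C <> 1 in T, multiply it by any nontrivial m in
   [N, C]: as N = C_N(C) x [N, C] is T-invariant, the stabiliser of n m is
   C_C(m), which is smaller. *)
Lemma coprime_abelian_regular_orbit N T :
    abelian N -> abelian T -> T \subset 'N(N) -> coprime #|N| #|T| ->
    'C_T(N) = 1 ->
  exists2 n, n \in N & 'C_T[n] = 1.
Proof.
move=> abN abT nNT coNT ffT.
case: (arg_minnP (fun n => #|'C_T[n]|) (group1 N)) => n Nn min_n.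
exists n => //; apply/eqP/idPn=> ntC; pose C := 'C_T[n]%G.
have sCT : C \subset T := subsetIl _ _.
have nNC := subset_trans sCT nNT.
have tiC : 'C_[~: N, C](C) = 1.
  apply: coprime_abel_cent_TI => //.
  by rewrite (coprime_dvdr (cardSg sCT)).
have sRN : [~: N, C] \subset N by rewrite commg_subl.
have [m Rm ntm] : exists2 m, m \in [~: N, C] & m != 1.
  apply/trivgPn; apply: contra ntC => /eqP R1.
  by rewrite -subG1 -ffT subsetI sCT centsC; apply/commG1P.
have Nm := subsetP sRN m Rm.
have cCn : n \in 'C(C) by apply/centP => c /setIP[_ /cent1P/commute_sym].
have nRT : T \subset 'N([~: N, C]).
  by rewrite normsR // cents_norm // (subset_trans abT) ?centS.
have pCT : 'C_T[n * m] \proper C.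
  have sCC : 'C_T[n * m] \subset C.
    apply/subsetP => t /setIP[Tt /cent1P ct]; rewrite inE Tt.
    have tJ : n ^ t * m ^ t = n * m by rewrite -conjMg /conjg -ct mulKg.
    have Rmt : m ^ t \in [~: N, C] by rewrite memJ_norm ?(subsetP nRT).
    (* The right side is in [[~: N, C]]. The left side is centralised by [C], as [t] normalises [C].
       So both are trivial and [t] fixes [n]. *)
    have e : n^-1 * n ^ t = m * (m ^ t)^-1.
      by apply: (mulIg (m ^ t)); rewrite mulgKV -mulgA tJ mulKg.
    have: n^-1 * n ^ t \in 'C_[~: N, C](C).
      rewrite inE {1}e groupM ?groupV //=.
      rewrite groupM ?groupV ?memJ_norm //.
      by apply: (subsetP (norms_cent _)) Tt; apply: sub_abelian_norm.
    rewrite tiC => /set1P/(canRL (mulKVg _)); rewrite mulg1 => ent.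
    by apply/cent1P/esym/commgP/conjg_fixP.
  (* If all of [C] fixed [n * m], it would fix [m], which lies in [[~: N, C]]. *)
  rewrite properE sCC; apply: contra ntm => sC.
  apply/eqP/set1P; rewrite -[[set 1]]tiC inE Rm; apply/centP => c Cc.
  have /setIP[_ /cent1P c1] := subsetP sC c Cc.
  have /cent1P c2 : c \in 'C[n] by case/setIP: Cc.
  by apply: (mulgI n); rewrite mulgA -c1 mulgA c2 mulgA.
have := proper_card pCT; rewrite ltnNge => /negP[].
by apply: min_n; apply: groupM.
Qed.

End RegularOrbit.

(** * Nilpotency of the Frattini subgroup *)

Section FrattiniNilpotent.

(** By the Frattini argument ['Phi(G)] and the normaliser of a Sylow subgroup [P] of it generate
    [G]; elements of ['Phi(G)] being non-generators, [P] is normal in [G]. *)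
Lemma Phi_nilpotent (gT : finGroupType) (G : {group gT}) : nilpotent 'Phi(G).
Proof.
have nPG := Phi_normal G.
suffices sPF : 'Phi(G) \subset 'F('Phi(G)).
  exact: nilpotentS sPF (Fitting_nil _).
rewrite -{1}(Sylow_gen 'Phi(G)) gen_subG.
apply/bigcupsP => P /SylowP[p p_pr sylP].
apply: Fitting_max; last exact: pgroup_nil (pHall_pgroup sylP).
have sP := pHall_sub sylP.
have defG := Frattini_arg nPG sylP.
have /Phi_nongen : 'Phi(G) <*> 'N_G(P) = G.
  by rewrite norm_joinEr ?subIset ?(normal_norm nPG).
rewrite genGid => nPG'; apply/andP; split=> //.
apply: subset_trans (Phi_sub G) _.
by have <- : 'N_G(P) = G := nPG'; apply: subsetIr.
Qed.

End FrattiniNilpotent.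

(** * Chains of normal subgroups *)

Section NormalChains.

Variables (gT : finGroupType) (G : {group gT}).
Implicit Types (A B K N : {group gT}) (c : seq {group gT}).

(** Factors need not be chief: for an upper bound by the chief length, strict inclusions suffice,
    and they lift easily from quotients. *)
Definition normal_chain K c :=
  path (fun A B : {group gT} => (A \proper B) && (B <| G)) K c.

(** Refine the chain to a chief series, extend it down to 1, and compare lengths by Jordan-Hoelder
    with constant weight 1. *)
Lemma normal_chain_chief K c : chief_series G c -> K <| G ->
  forall d, normal_chain K d -> last K d = G -> size d <= size c.
Proof.
case/andP=> chc /eqP lc nK d chd ld.
have [s [chs ls leds]] : exists s,
    [/\ (G.-chief).-series K s, last K s = last K d & size d <= size s].
  elim: d K nK chd {ld} => [|A d IHd] K nK /=; first by exists [::].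
  case/andP=> /andP[pKA nA] /(IHd _ nA)[s [chs ls les]].
  have [t cht lt] := chief_path_exists nK nA (proper_sub pKA).
  exists (t ++ s); rewrite cat_path last_cat lt cht; split=> //.
  case: t cht lt => [_ /= eK | B t _ _]; first by rewrite eK properxx in pKA.
  by rewrite size_cat addSn ltnS (leq_trans les) ?leq_addl.
have [t cht lt] := chief_path_exists (normal1 G) nK (sub1G K).
have wE e : chief_weight (fun _ _ : {group gT} => 1%N) 1%G e = size e.
  elim: e {c chc lc} (1%G : {group gT}) => [|A e IHe] B.
    exact: chief_weight_nil.
  by rewrite chief_weight_cons IHe.
rewrite -(wE c) (@chief_weight_unique _ G _ _ _ c (t ++ s)) ?normal1 //.
- by rewrite wE size_cat (leq_trans leds) ?leq_addl.
- by rewrite cat_path cht lt.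
by rewrite last_cat lt ls.
Qed.

End NormalChains.

(** * A minimal normal subgroup and its complement *)

Section MinimalNormal.

Variables (gT : finGroupType) (G : {group gT}).
Hypotheses (solG : solvable G) (Phi1 : 'Phi(G) = 1).
Variables (N M : {group gT}).
Hypotheses (minN : minnormal N G) (nN : N <| G).
Hypotheses (maxM : maximal M G) (nsNM : ~~ (N \subset M)).

Let P := (coset N @*^-1 'Phi(G / N))%G.
(** Since [M] complements [N] in [G], [R] complements [N] in [P]. *)
Let R := (P :&: M)%G.

Let sMG : M \subset G. Proof. exact: proper_sub (maxgroupp maxM). Qed.
Let defG : N * M = G. Proof. exact: mul_maximal. Qed.

Let abelN : is_abelem N.
Proof. by case: (minnormal_solvable minN (normal_sub nN) solG). Qed.

Let abN : abelian N.
Proof. by case/is_abelemP: abelN => p _ /abelem_abelian. Qed.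

Lemma minnormal_sub_or_TI (H : {group gT}) :
  H <| G -> N :&: H = 1 \/ N \subset H.
Proof.
move=> nH; have [N1 | ntN] := eqVneq (N :&: H) 1; first by left.
right; case/mingroupP: minN => _ /(_ (N :&: H)%G); rewrite /= ntN.
by rewrite normsI ?normal_norm // => <-; rewrite ?subsetIr ?subsetIl.
Qed.

Let tiNM : N :&: M = 1.
Proof.
have nNM : N :&: M <| G.
  by apply: normal_cap_maximal => //; rewrite (commG1P abN) sub1G.
case: (@minnormal_sub_or_TI (N :&: M)%G nNM) => /=.
  by rewrite setIA setIid.
by rewrite subsetI (negbTE nsNM) andbF.
Qed.

Let nP : P <| G.
Proof. by rewrite -(quotientGK nN) cosetpre_normal Phi_normal. Qed.

Let sNP : N \subset P. Proof. exact: sub_cosetpre. Qed.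

Let Phi_sub_maximal (H : {group gT}) :
  maximal H G -> N \subset H -> P \subset H.
Proof.
move=> maxH sNH; have sPG := normal_sub nP.
apply: (frattini_factorP nN sPG _ H) => //.
by rewrite /frattini_factor cosetpreK.
Qed.

(** The centraliser [C] is normal in [G], so if nontrivial it is missed by some maximal [L], and
    [M = C (L :&: M)]. A maximal subgroup above [N] and [L :&: M] would contain [P], hence [C], [M]
    and all of [G]; so [G = N (L :&: M)]. Then [L :&: M = M], hence [L = M] contains [C]. *)
Lemma frattini_complement_faithful : 'C_R(N) = 1.
Proof.
pose C := 'C_R(N)%G; apply/eqP/idPn => ntC.
have nCN : 'C_G(N) <| G.
  by rewrite /normal subsetIl normsI ?normG ?norms_cent ?normal_norm.
have eC : C :=: P :&: 'C_G(N) :&: M.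
  by rewrite /= setIA (setIidPl (normal_sub nP)) setIAC.
have sCM : C \subset M by rewrite eC subsetIr.
have sCP : C \subset P by rewrite eC -setIA subsetIl.
have nC : C <| G.
  apply/andP; split; first exact: subset_trans sCM sMG.
  rewrite -{1}defG mul_subG //; first by rewrite cents_norm // centsC subsetIr.
  by rewrite eC normsI ?normG // normsI ?(subset_trans sMG) ?normal_norm.
have [|L maxL nsCL] := exists_maximal_not_sub (normal_sub nC).
  by rewrite Phi1 subG1.
have sLG := proper_sub (maxgroupp maxL).
have defM : C * (L :&: M) = M.
  by rewrite group_modl // (mul_maximal maxL nC nsCL) (setIidPr sMG).
have nNI : L :&: M \subset 'N(N).
  exact: subset_trans (subset_trans (subsetIl _ _) sLG) (normal_norm nN).
have defG' : N * (L :&: M) = G.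
  have [|eG|[H maxH]] := @maximal_exists _ (N <*> (L :&: M))%G G.
  - by rewrite join_subG (normal_sub nN) subIset ?sLG.
  - by rewrite -norm_joinEr //; apply: eG.
  rewrite join_subG => /andP[sNH sIH].
  have sMH : M \subset H.
    by rewrite -defM mul_subG // (subset_trans sCP) // Phi_sub_maximal.
  have := proper_subn (maxgroupp maxH).
  by rewrite -defG mul_subG.
have eI : L :&: M = M.
  rewrite -[RHS](setIidPl sMG) -defG' -group_modr ?subsetIr //.
  by rewrite [M :&: N]setIC tiNM mul1g.
case/negP: nsCL; rewrite -(subset_maximal maxM maxL) //.
by rewrite -eI subsetIl.
Qed.

(** [R] embeds in the nilpotent group ['Phi(G / N)], so for the prime [p] of [N] it is enough that
    ['O_p(R)] be trivial. With [N] it generates a normal p-subgroup [Q]; by minimality [N] is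
    central in [Q], and [R] acts faithfully on [N]. *)
Lemma frattini_complement_coprime : coprime #|N| #|R|.
Proof.
have [p _ abelpN] := is_abelemP abelN; have pN := abelem_pgroup abelpN.
have nilR : nilpotent R.
  have nNR : R \subset 'N(N).
    exact: subset_trans (subset_trans (subsetIr _ _) sMG) (normal_norm nN).
  have tiNR : N :&: R = 1.
    by apply/trivgP; rewrite -tiNM setIS // subsetIr.
  rewrite (isog_nil (quotient_isog nNR tiNR)).
  apply: nilpotentS (Phi_nilpotent (G / N)).
  by rewrite sub_quotient_pre // subsetIl.
suffices R1 : 'O_p(R) = 1.
  have := nilpotent_pcore_Hall p nilR; rewrite R1 => /and3P[_ _].
  by rewrite indexg1 => p'R; apply: pnat_coprime pN p'R.
pose Q := (N <*> 'O_p(R))%G.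
have sOM : 'O_p(R) \subset M.
  by rewrite (subset_trans (pcore_sub _ _)) ?subsetIr.
have nNO : 'O_p(R) \subset 'N(N) :=
  subset_trans (subset_trans sOM sMG) (normal_norm nN).
have nRM : M \subset 'N(R).
  by rewrite normsI ?normG // (subset_trans sMG) ?normal_norm.
have nQ : Q <| G.
  apply/andP; split.
    by rewrite join_subG (normal_sub nN) (subset_trans sOM).
  rewrite -{1}defG mul_subG //.
    exact: subset_trans (joing_subl N 'O_p(R)) (normG _).
  rewrite normsY ?(subset_trans sMG (normal_norm nN)) //.
  exact: char_norm_trans (pcore_char p R) nRM.
have pQ : p.-group Q by rewrite /= norm_joinEr // pgroupM pN pcore_pgroup.
have nsNQ : N <| Q by apply: normalS nN; rewrite ?joing_subl ?normal_sub.
have ntN : N :!=: 1 by case/mingroupP: minN => /andP[].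
have /= ntNZ := meet_center_nil (pgroup_nil pQ) nsNQ ntN.
have nZ : 'Z(Q) <| G by apply: gFnormal_trans.
case: (@minnormal_sub_or_TI 'Z(Q)%G nZ) => [NZ1 | sNZ].
  by rewrite NZ1 eqxx in ntNZ.
apply/trivgP; rewrite -frattini_complement_faithful subsetI pcore_sub centsC.
apply: subset_trans sNZ (subset_trans (subsetIr _ _) _).
by rewrite centS // joing_subr.
Qed.

(* If V / U is a chief factor and the intersection D <= M avoids U, then V :&: D
   is abelian, so it has a regular orbit on N, i.e. some conjugate of the
   complement M of N avoids it. *)
Lemma cut_frattini_step (U : {group gT}) (X : {set {group gT}}) :
    U <| G -> N \subset U -> U \subset P -> M \in X ->
    {in X, forall H : {group gT}, maximal H G} ->
    U :&: \bigcap_(H in X) H = 1 ->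
  exists (Y : {set {group gT}}) d,
              [/\ {in Y, forall H : {group gT}, maximal H G},
                  P :&: \bigcap_(H in Y) H = 1,
                  normal_chain G U d, last U d = P
                & #|Y| <= #|X| + size d].
Proof.
have [m] := ubnP (#|P| - #|U|).
elim: m U X => // m IHm U X ltm nU sNU sUP XM maxX capX.
have [eUP | neUP] := eqVneq U P.
  by exists X, [::]; rewrite addn0 -eUP.
have pUP : U \proper P by rewrite properEneq neUP.
have [V chV sVP] := chief_factor_exists nU nP pUP.
have [_ pUV nV _] := chief_factorP chV.
pose D := (\bigcap_(H in X) H)%G; pose T := (V :&: D)%G.
have sDM : D \subset M by apply: bigcap_inf.
have sTR : T \subset R by apply: setISS.
have sTM : T \subset M := subset_trans sTR (subsetIr _ _).
have abT : abelian T.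
  apply/commG1P/trivgP; rewrite -capX subsetI.
  rewrite (subset_trans _ (chief_factor_der1 solG chV)) ?commgSS ?subsetIl //=.
  by rewrite (subset_trans (der_sub 1 T)) ?subsetIr.
have nNT : T \subset 'N(N) :=
  subset_trans (subset_trans sTM sMG) (normal_norm nN).
have [||n Nn regn] := coprime_abelian_regular_orbit abN abT nNT.
- exact: coprimegS sTR frattini_complement_coprime.
- by apply/trivgP; rewrite -frattini_complement_faithful setSI.
have Gn := subsetP (normal_sub nN) n Nn.
have maxMn : maximal (M :^ n) G by rewrite -(conjGid Gn) maximalJ.
(* For [t] in both [M] and [M :^ n], the commutator of [t] and [n^-1] lies in [N :&: M = 1], so [t]
   fixes [n]. *)
have tiTM : T :&: M :^ n = 1.
  apply/trivgP; rewrite -regn; apply/subsetP => t /setIP[Tt].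
  rewrite mem_conjg => Mt; rewrite inE Tt /=; apply/cent1P.
  have: [~ t, n^-1] \in N :&: M.
    apply/setIP; split.
      by rewrite commgEr groupM ?memJ_norm ?groupV // (subsetP nNT).
    by rewrite commgEl groupM ?groupV // (subsetP sTM).
  by rewrite tiNM => /set1P/eqP/commgP/commuteV; rewrite invgK.
have [||||||| Y [d [maxY capY chd ld leY]]] := IHm V ((M :^ n)%G |: X);
  rewrite ?setU1r //.
- by apply: leq_trans (ltm : _ <= m); rewrite ltn_sub2l ?proper_card.
- exact: subset_trans sNU (proper_sub pUV).
- exact: maximal_setU1.
- by rewrite bigcap_setU1 setIA setIAC -/T.
exists Y, (V :: d); split=> //=; first by rewrite pUV nV.
by rewrite (leq_trans leY) // addnS -addSn leq_add2r leq_card_setU1.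
Qed.

(** The climb starts at [U = N] with [M] alone, which the factor from 1 to [N] pays for. *)
Lemma cut_frattini :
  exists (X : {set {group gT}}) c,
              [/\ {in X, forall H : {group gT}, maximal H G},
                  P :&: \bigcap_(H in X) H = 1,
                  normal_chain G 1%G c, last 1%G c = P
                & #|X| <= size c].
Proof.
have [||||| | X [d [maxX capX chd ld leX]]] := @cut_frattini_step N [set M];
  rewrite ?set11 ?big_set1 //.
  by move=> H /set1P->.
exists X, (N :: d); rewrite cards1 in leX; split=> //=.
by rewrite nN proper1G; case/mingroupP: minN => /andP[->].
Qed.

End MinimalNormal.

(** * Lifting from a quotient and the chief length bound *)

Section Lift.

Variables (gT : finGroupType) (G N : {group gT}).
Hypothesis nN : N <| G.

Lemma cosetpre_normal_chain (K : {group coset_of N}) c :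
  normal_chain (G / N) K c ->
  normal_chain G (coset N @*^-1 K)%G
    [seq (coset N @*^-1 A)%G | A : {group coset_of N} <- c].
Proof.
elim: c K => //= A c IHc K /andP[/andP[pKA nA] /IHc->].
by rewrite cosetpre_proper pKA -(quotientGK nN) cosetpre_normal nA.
Qed.

Lemma cosetpre_family (X : {set {group coset_of N}}) :
    {in X, forall Q : {group coset_of N}, maximal Q (G / N)} ->
    G / N :&: \bigcap_(Q in X) Q = 'Phi(G / N) ->
  exists Y : {set {group gT}},
   [/\ {in Y, forall M : {group gT}, maximal M G},
       G :&: \bigcap_(M in Y) M \subset coset N @*^-1 'Phi(G / N)
     & #|Y| <= #|X|].
Proof.
move=> maxX capX.
exists [set (coset N @*^-1 Q)%G | Q : {group coset_of N} in X].
split; last exact: leq_imset_card.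
  move=> _ /imsetP[Q /maxX maxQ ->].
  by rewrite -(quotientGK nN) cosetpre_maximal.
apply/subsetP => x /setIP[Gx /bigcapP capx].
have Nx := subsetP (normal_norm nN) x Gx.
rewrite mem_morphpre // -capX inE mem_quotient //=; apply/bigcapP => Q XQ.
have: x \in coset N @*^-1 Q.
  by apply: (capx (coset N @*^-1 Q)%G); apply: imset_f.
by case/morphpreP.
Qed.

End Lift.

(* The chain starts at 'Phi(G) rather than at 1: in the induction step this
   leaves room for the chief factors of G inside the preimage of 'Phi(G / N). *)
Lemma frat_family_chain (gT : finGroupType) (G : {group gT}) :
  solvable G ->
  exists (X : {set {group gT}}) c,
              [/\ frat_family G X, normal_chain G 'Phi(G)%G c,
                  last 'Phi(G)%G c = G & #|X| <= size c].
Proof.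
have [m] := ubnP #|G|; elim: m gT G => // m IHm gT G ltGm solG.
have lift (N : {group gT}) : N <| G -> N :!=: 1 ->
  exists (X : {set {group gT}}) c,
    [/\ {in X, forall M : {group gT}, maximal M G},
        G :&: \bigcap_(M in X) M \subset coset N @*^-1 'Phi(G / N),
        normal_chain G (coset N @*^-1 'Phi(G / N))%G c,
        last (coset N @*^-1 'Phi(G / N))%G c = G & #|X| <= size c].
  move=> nN ntN.
  have [||X [c [/andP[/forall_inP maxX /eqP capX] chc lc leX]]] :=
    IHm _ (G / N)%G.
  - by apply: leq_trans (ltGm : _ <= m); rewrite ltn_quotient ?normal_sub.
  - exact: quotient_sol.
  have [Y [maxY capY leY]] := cosetpre_family nN maxX capX.
  exists Y, [seq (coset N @*^-1 A)%G | A : {group coset_of N} <- c]; split=> //.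
  - exact: cosetpre_normal_chain chc.
  - rewrite last_map (_ : last _ _ = (G / N)%G) //.
    by apply: group_inj; rewrite /= quotientGK.
  by rewrite size_map (leq_trans leY).
(* When ['Phi(G)] is nontrivial, [lift] with [N := 'Phi(G)] suffices, as ['Phi(G / 'Phi(G))] is
   trivial. *)
have [Phi1 | ntPhi] := eqVneq 'Phi(G) 1; last first.
  have [X [c [maxX capX chc lc leX]]] := lift _ (Phi_normal G) ntPhi.
  have ePhi : (coset 'Phi(G) @*^-1 'Phi(G / 'Phi(G)))%G = 'Phi(G)%G.
    by apply: group_inj; rewrite /= Phi_quotient_id cosetpre1.
  rewrite ePhi in chc lc; exists X, c; split=> //; apply: frat_familyE => //.
  by rewrite Phi_quotient_id cosetpre1 in capX.
have ePhi : 'Phi(G)%G = 1%G by apply: group_inj.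
have [G1 | ntG] := eqVneq G 1%G.
  exists set0, [::]; rewrite cards0 ePhi; split=> //; apply: frat_familyE.
    by move=> M; rewrite inE.
  by rewrite subIset // G1 sub1G.
have [N minN sNG] := minnormal_exists ntG (normG G).
have /andP[ntN nNG] := mingroupp minN.
have nN : N <| G by apply/andP.
have [|M maxM nsNM] := exists_maximal_not_sub sNG; first by rewrite Phi1 subG1.
have [X1 [c1 [maxX1 capX1 chc1 lc1 leX1]]] := lift N nN ntN.
have [X2 [c2 [maxX2 capX2 chc2 lc2 leX2]]] :=
  cut_frattini solG Phi1 minN nN maxM nsNM.
(* [X1] brings the intersection into the preimage of ['Phi(G / N)], where [X2] makes it trivial; the
   two chains meet at that preimage. *)
exists (X1 :|: X2), (c2 ++ c1); rewrite ePhi; split.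
- apply: frat_familyE => [H /setUP[/maxX1 | /maxX2] // |].
  by rewrite Phi1 -capX2 bigcap_setU /= setIA setSI.
- by rewrite /normal_chain cat_path lc2; apply/andP.
- by rewrite last_cat lc2.
by rewrite size_cat cardsU (leq_trans (leq_subr _ _)) // addnC leq_add.
Qed.

(* lambda(G) = size s and delta(G) = delta_of G s for any chief series s of G. *)
Theorem theorem3 (gT : finGroupType) (G : {group gT}) (s : seq {group gT}) :
  solvable G -> chief_series G s ->
  (alpha G <= size s)%N /\ (nilpotent G^`(1) -> (alpha G <= delta_of G s)%N).
Proof.
move=> solG chs; split; last exact: alpha_le_delta.
have [X [c [fX chc lc leX]]] := frat_family_chain solG.
apply: leq_trans (alpha_le fX) (leq_trans leX _).
exact: (normal_chain_chief chs (Phi_normal G) chc).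
Qed.
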